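(* Assume $n\geq 7$ is prime. Then $d(\Xi(S_n))\geq 4$.
   Context: A subset $\{x_1,\ldots,x_t\}$ of a finite group $G$ invariably generates $G$ if $\langle x_1^{g_1},\ldots,x_t^{g_t}\rangle=G$ for all $g_1,\ldots,g_t\in G$ (where $x^g$ denotes a conjugate of $x$). The invariably generating graph $\Lambda(G)$ is the undirected graph whose vertices are the conjugacy classes of $G$ different from $\{1\}$, two vertices $x^G$ and $y^G$ being adjacent if and only if $\{x,y\}$ invariably generates $G$. The graph $\Xi(G)$ is obtained from $\Lambda(G)$ by removing the isolated vertices (those adjacent to no vertex), and $d(\Xi(G))$ denotes its diameter (which is infinite if the graph is disconnected). *)

(* Defs.v *)
From HB Require Import structures.
From mathcomp Require Import all_boot all_order all_algebra all_fingroup.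
From mathcomp Require Import constructive_ereal.

Set Implicit Arguments.
Unset Strict Implicit.
Unset Printing Implicit Defensive.

Import Order.TTheory GRing.Theory Num.Theory.

Record sgraph := SGraph {
  vertex :> finType;
  adj : rel vertex;
  adj_sym : symmetric adj;
  adj_irr : irreflexive adj }.

Section Diameter.
Variable Gr : sgraph.
Implicit Types x y : Gr.

Definition walk (k : nat) x y : bool :=
  [exists p : k.-tuple Gr, path (@adj Gr) x p && (last x p == y)].

(* Values are in the integers with -oo and +oo adjoined; dist x y is +oo when
   no walk joins x to y.  Only lengths k < #|Gr| need be considered, because
   a shortest walk does not repeat vertices (see dist_le_walk). *)
Definition dist x y : \bar int :=
  \big[Order.min/+oo%E]_(k < #|Gr| | walk k x y) ((k : nat)%:Z)%:E%E.

Definition diam : \bar int :=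
  \big[Order.max/0%E]_(x : Gr) \big[Order.max/0%E]_(y : Gr) dist x y.

Lemma dist_le_walk k x y : walk k x y -> (dist x y <= (k%:Z)%:E)%E.
Proof.
case/existsP=> p /andP[xp /eqP <-].
case/shortenP: xp => q xq q_uniq q_sub.
have lt_q : size q < #|Gr| by have := max_card (mem (x :: q)); rewrite (card_uniqP q_uniq).
have le_q : size q <= k.
  rewrite -(size_tuple p); apply: uniq_leq_size => //.
  by case/andP: q_uniq.
have wq : walk (Ordinal lt_q) x (last x q).
  by apply/existsP; exists (in_tuple q); rewrite /= xq eqxx.
rewrite /dist (bigD1 (Ordinal lt_q)) //= ge_min; apply/orP; left.
by rewrite lee_fin lez_nat.
Qed.

End Diameter.

Section RemoveIsolated.
Variable Gr : sgraph.

Definition nonisolated : pred Gr := [pred x | [exists y, adj x y]].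

Definition noniso_adj : rel {x : Gr | nonisolated x} :=
  fun x y => adj (val x) (val y).

Lemma noniso_adj_sym : symmetric noniso_adj.
Proof. by move=> x y; exact: adj_sym. Qed.

Lemma noniso_adj_irr : irreflexive noniso_adj.
Proof. by move=> x; exact: adj_irr. Qed.

Definition remove_isolated : sgraph := SGraph noniso_adj_sym noniso_adj_irr.

End RemoveIsolated.

Section InvariablyGeneratingGraph.
Local Open Scope group_scope.
Variables (gT : finGroupType) (G : {group gT}).

(* The conjugating elements g are chosen independently for each x in X. *)
Definition invariably_generates (X : {set gT}) : bool :=
  (X \subset G) &&
  [forall (g : {ffun gT -> gT} | g \in ffun_on (mem G)),
     <<[set x ^ g x | x in X]>> == G].

Definition nontrivial_class : pred {set gT} := [pred A | A \in classes G :\ 1].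

(* Whether [set x; y] invariably generates does not depend on the choice of
   x and y in two distinct classes A and B (see lambda_adjP). *)
Definition lambda_adj : rel {A : {set gT} | nontrivial_class A} :=
  fun A B => (A != B) &&
    [exists x in val A, exists y in val B, invariably_generates [set x; y]].

Lemma lambda_adj_sym : symmetric lambda_adj.
Proof.
have sub A B : lambda_adj A B -> lambda_adj B A.
  rewrite /lambda_adj eq_sym => /andP[-> /existsP[x /andP[xA /existsP[y /andP[yB ig]]]]].
  apply/existsP; exists y; rewrite yB; apply/existsP; exists x.
  by rewrite xA setUC.
by move=> A B; apply/idP/idP; apply: sub.
Qed.

Lemma lambda_adj_irr : irreflexive lambda_adj.
Proof. by move=> A; rewrite /lambda_adj eqxx. Qed.

Definition Lambda : sgraph := SGraph lambda_adj_sym lambda_adj_irr.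

Definition Xi : sgraph := remove_isolated Lambda.

Lemma lambda_adjP (A B : {C : {set gT} | nontrivial_class C}) x y :
  x \in val A -> y \in val B -> A != B ->
  lambda_adj A B = invariably_generates [set x; y].
Proof.
move=> xA yB neqAB; rewrite /lambda_adj neqAB /=.
have clE (C : {C : {set gT} | nontrivial_class C}) z w : z \in val C -> w \in val C ->
    exists2 h, h \in G & z = w ^ h.
  have /setD1P[_ /imsetP[u uG ->]] := valP C.
  move=> zC wC; have wG : w ^: G = u ^: G by apply/class_eqP.
  by move: zC; rewrite -wG => /imsetP[h hG ->]; exists h.
apply/existsP/idP => [[x' /andP[x'A /existsP[y' /andP[y'B]]]] | ig]; last first.
  by exists x; rewrite xA; apply/existsP; exists y; rewrite yB.
have [h hG ->] := clE A x x' xA x'A.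
have [k kG ->] := clE B y y' yB y'B.
move=> /andP[sub /forall_inP ig]; apply/andP; split.
  move: sub; rewrite !subUset !sub1set => /andP[x'G y'G].
  by rewrite !groupJ.
have neq' : x' != y'.
  apply: contraNneq neqAB => eqxy; apply/eqP/val_inj.
  have /setD1P[_ /imsetP[u uG Au]] := valP A.
  have /setD1P[_ /imsetP[v vG Bv]] := valP B.
  move: x'A y'B; rewrite Au Bv eqxy => /class_eqP yu /class_eqP yv.
  by transitivity (u ^: G); [exact: Au | rewrite -yu yv; exact: esym Bv].
apply/forall_inP => g /ffun_onP gG.
pose g' := [ffun z => if z == x' then h * g (x' ^ h) else k * g (y' ^ k)].
have g'G : g' \in ffun_on (mem G).
  by apply/ffun_onP => z; rewrite ffunE; case: ifP => _; rewrite groupM ?gG.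
rewrite -(eqP (ig g' g'G)) !imsetU1 !imset_set1 !ffunE eqxx.
by rewrite [y' == x']eq_sym (negPf neq') !conjgM.
Qed.

End InvariablyGeneratingGraph.

(* Main.v *)
(* A transposition t stabilises sets of every size, so its
   only neighbour is the class of n-cycles.  Let y be the even one among the
   cycle types (3, 2, ..., 2) and (4, 3, 2, ..., 2).  It stabilises sets of all
   sizes 2, ..., n - 2 and a neighbour of y must be odd, hence not an n-cycle;
   so its only neighbour is the class of (n-1)-cycles.  Up to conjugation an
   n-cycle and an (n-1)-cycle are x |-> x + 1 and x |-> g x in AGL_1(n), so they
   are not adjacent and t, y are at distance at least 4.  Neither vertex is
   isolated: for y, use that y^4 is a 3-cycle lying in a 2-transitive group. *)

Require Import Defs.
From HB Require Import structures.
From mathcomp Require Import all_boot all_order all_algebra all_fingroup.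
From mathcomp Require Import cyclic alt zify.
From mathcomp Require Import constructive_ereal.

Set Implicit Arguments.
Unset Strict Implicit.
Unset Printing Implicit Defensive.

(** * Permutations with few stable sets *)

Section Permutations.
Local Open Scope group_scope.
Variable T : finType.
Implicit Types (s t u w y h : {perm T}) (A B : {set T}) (a b c x z : T).

Lemma ex_perm_map (L1 L2 : seq T) :
  uniq L1 -> uniq L2 -> size L1 = size L2 -> exists h, map h L1 = L2.
Proof.
elim: L1 L2 => [|x L1 IH] [|z L2] //= => [_ _ _|]; first by exists 1.
move=> /andP[xL1 uL1] /andP[zL2 uL2] [/(IH _ uL1 uL2)[h hL]]; subst L2.
(* The factor [tperm (h x) z] corrects the value at [x]; it fixes the images of [L1], which include
   neither [h x] nor [z]. *)
exists (h * tperm (h x) z); rewrite permM tpermL; congr (_ :: _).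
apply/eq_in_map => v vL1; rewrite permM tpermD //.
  by apply: contraNneq xL1 => /perm_inj->.
by apply: contraNneq zL2 => ->; apply: map_f.
Qed.

Definition stable s A := [forall x, (s x \in A) == (x \in A)].

Lemma stableP s A : reflect (forall x, (s x \in A) = (x \in A)) (stable s A).
Proof. exact: 'forall_eqP. Qed.

Lemma stableC s A : stable s A -> stable s (~: A).
Proof. by move/stableP=> sA; apply/stableP => x; rewrite !inE sA. Qed.

Lemma stableJ s h A : stable s A -> stable (s ^ h) (h @: A).
Proof.
move/stableP=> sA; apply/stableP => x; rewrite -[x](permKV h) permJ.
by rewrite !mem_imset ?sA //; apply: perm_inj.
Qed.

Lemma porbit_permE s x z : (s z \in porbit s x) = (z \in porbit s x).
Proof. by rewrite -!eq_porbit_mem -(porbit_perm s 1 z) expg1. Qed.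

Lemma stable_porbit s x : stable s (porbit s x).
Proof. by apply/stableP => z; apply: porbit_permE. Qed.

(** The permutations stabilising [A] form a subgroup, which misses every transposition of a point
    inside with a point outside. *)
Lemma gen_stable_proper s t A :
  stable s A -> stable t A -> A != set0 -> A != setT ->
  <<[set s; t]>> != [set: {perm T}].
Proof.
move=> sA tA /set0Pn[x xA]; rewrite -(inj_eq (@setC_inj T)) setCT => /set0Pn[z zA].
apply/eqP => gen.
have : tperm x z \in <<[set s; t]>> by rewrite gen inE.
have grpA : group_set [set h | stable h A].
  apply/group_setP; split=> [|h k]; rewrite !inE; first by apply/stableP => v; rewrite perm1.
  by move=> /stableP hA /stableP kA; apply/stableP => v; rewrite permM kA hA.
have sub : <<[set s; t]>> \subset group grpA.
  by rewrite gen_subG subUset !sub1set !inE sA tA.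
move=> /(subsetP sub); rewrite inE => /stableP/(_ x).
by rewrite tpermL xA; rewrite inE in zA; rewrite (negPf zA).
Qed.

(** The obstruction to invariable generation: sets of equal size are permuted transitively, so [s]
    can be conjugated to stabilise [B]. *)
Lemma conj_stable_gen_proper s t A B :
  stable s A -> stable t B -> #|A| = #|B| -> 0 < #|B| < #|T| ->
  exists h, <<[set s ^ h; t]>> != [set: {perm T}].
Proof.
move=> sA tB eqAB /andP[B_gt0 ltBT].
have [|h hAB] := ex_perm_map (enum_uniq A) (enum_uniq B); first by rewrite -!cardE.
have {}hAB : h @: A = B.
  by apply/setP => x; rewrite -[RHS]mem_enum -hAB; apply/imsetP/mapP => -[z zA ->];
     exists z; rewrite ?mem_enum // -mem_enum.
exists h; apply: (@gen_stable_proper _ _ B) => //.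
- by rewrite -hAB stableJ.
- by rewrite -card_gt0.
by apply: contraTneq ltBT => ->; rewrite cardsT ltnn.
Qed.

(** * Conjugacy, parity and order of long cycles *)

Lemma cycle_conj s t x z :
  (forall v, v \notin porbit s x -> s v = v) ->
  (forall v, v \notin porbit t z -> t v = v) ->
  #|porbit s x| = #|porbit t z| -> exists h, s ^ h = t.
Proof.
move=> fix_s fix_t eq_card.
have [|h map_h] := ex_perm_map (uniq_traject_porbit s x) (uniq_traject_porbit t z).
  by rewrite !size_traject.
(* The orbit lists matched by [h] only cover exponents below the orbit size, so [i] is first reduced
   modulo it. *)
have hX i : h ((s ^+ i) x) = (t ^+ i) z.
  have m_gt0 : 0 < #|porbit s x| by rewrite lt0n card_porbit_neq0.
  have modX (r : {perm T}) v : (r ^+ i) v = (r ^+ (i %% #|porbit r v|)) v.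
    rewrite {1}(divn_eq i #|porbit r v|) expgD permM mulnC expgM.
    by rewrite (permX_fix (s := r ^+ _)) // permX iter_porbit.
  rewrite modX (modX t) -eq_card; set j := i %% _.
  have lt_j : j < #|porbit s x| by rewrite ltn_mod.
  move/(congr1 (nth z ^~ j)): map_h.
  by rewrite (nth_map x) ?size_traject // !nth_traject -?eq_card // !permX.
exists h; apply/permP => v; rewrite -[v](permKV h) permJ; move: (h^-1 v) => {}v.
have [/porbitP[i ->]|v_notin] := boolP (v \in porbit s x).
  by rewrite -(permM (s ^+ i) s) -expgSr !hX expgSr permM.
rewrite fix_s // fix_t //; apply: contra v_notin => /porbitP[i].
by rewrite -hX => /perm_inj->; apply: mem_porbit.
Qed.

(** From here on [porbit s x = setT] encodes a full cycle, and [porbit s x = [set~ a]] a cycle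
    through all points but the fixed point [a]. *)
Lemma transitive_conj s t x z :
  porbit s x = setT -> porbit t z = setT -> exists h, s ^ h = t.
Proof.
move=> sx tz; apply: (@cycle_conj _ _ x z); rewrite ?sx ?tz // => v;
  by rewrite in_setT.
Qed.

Lemma porbit_setC1_fix s x a : porbit s x = [set~ a] -> s a = a.
Proof.
by move=> sx; apply/eqP/negPn; rewrite -in_setC1 -sx porbit_permE sx !inE eqxx.
Qed.

Lemma porbit_setC1_conj s t x z a b :
  porbit s x = [set~ a] -> porbit t z = [set~ b] -> exists h, s ^ h = t.
Proof.
move=> sx tz; apply: (@cycle_conj _ _ x z); last by rewrite sx tz !cardsC1.
  by move=> v; rewrite sx !inE negbK => /eqP->; apply: porbit_setC1_fix sx.
by move=> v; rewrite tz !inE negbK => /eqP->; apply: porbit_setC1_fix tz.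
Qed.

(** Parity is that of [#|T|] plus the number of orbits, which is one here and two in
    [odd_porbit_setC1]. *)
Lemma odd_porbit_setT s x : porbit s x = setT -> odd #|T| -> ~~ odd_perm s.
Proof.
move=> sx oddT; rewrite /odd_perm oddT.
suff -> : porbits s = [set setT] by rewrite cards1.
apply/setP => A; rewrite inE; apply/imsetP/eqP => [[z _ ->]|->]; last by exists x.
by rewrite -sx; apply/eqP; rewrite eq_porbit_mem sx.
Qed.

Lemma order_porbit_setT s x : porbit s x = setT -> #[s] = #|T|.
Proof.
move=> sx; apply/eqP; rewrite eqn_dvd -cardsT; apply/andP; split; last first.
  by rewrite -sx porbitE; apply: dvdn_orbit.
rewrite order_dvdn; apply/eqP/permP => z; rewrite perm1 -sx.
have -> : porbit s x = porbit s z by apply/eqP; rewrite eq_porbit_mem porbit_sym sx.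
by rewrite permX iter_porbit.
Qed.

(** * Generation of the symmetric group by 3-cycles *)

Definition cyc3 x z v := tperm x z * tperm x v.

Lemma cyc3J x z v h : cyc3 x z v ^ h = cyc3 (h x) (h z) (h v).
Proof. by rewrite conjMg !tpermJ. Qed.

Lemma cyc3V x z v : (cyc3 x z v)^-1 = cyc3 x v z.
Proof. by rewrite invMg !tpermV. Qed.

Lemma cyc3_rot x z v : v != x -> v != z -> cyc3 x z v = cyc3 z v x.
Proof.
move=> vx vz; rewrite /cyc3 conjgCV tpermV tpermJ tpermL tpermD ?(eq_sym _ v) //.
by rewrite (tpermC z x).
Qed.

Lemma cyc3E x z v : v != x -> v != z -> z != x ->
  [/\ cyc3 x z v x = z, cyc3 x z v z = v & cyc3 x z v v = x].
Proof.
move=> vx vz zx; rewrite /cyc3 !permM tpermL tpermR tpermL.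
rewrite (tpermD (x := x) (y := z) (z := v)) ?(eq_sym _ v) // tpermR.
by rewrite tpermD ?(eq_sym x) // eq_sym.
Qed.

Lemma cyc3_notin x z v c : c != x -> c != z -> c != v -> cyc3 x z v c = c.
Proof. by move=> cx cz cv; rewrite permM !tpermD // eq_sym. Qed.

(* Two 3-cycles (x z v) and (c x d) of H with c outside {x, z, v} share one or
   two points, so they generate Alt_4 or Alt_5, which contains (x z c). *)
Lemma cyc3_extend (H : {group {perm T}}) x z v c d :
  uniq [:: x; z; v; c] -> d != c -> d != x ->
  cyc3 x z v \in H -> cyc3 c x d \in H -> cyc3 x z c \in H.
Proof.
rewrite /= !inE !negb_or -!andbA => /and5P[xz xv xc zv /and3P[zc vc _]] dc dx Hxzv Hcxd.
have HJ h r1 r2 r3 : h \in H -> cyc3 r1 r2 r3 \in H -> cyc3 (h r1) (h r2) (h r3) \in H.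
  by move=> Hh Hr; rewrite -cyc3J groupJ.
have HV r1 r2 r3 : cyc3 r1 r2 r3 \in H -> cyc3 r1 r3 r2 \in H.
  by move=> Hr; rewrite -cyc3V groupV.
have [vx vz zx] : [/\ v != x, v != z & z != x] by split; rewrite eq_sym.
have [cx cz cv] : [/\ c != x, c != z & c != v] by split; rewrite eq_sym.
have [Ex Ez Ev] := cyc3E vx vz zx.
have Ec := cyc3_notin cx cz cv.
have [dz|dz] := eqVneq d z.
  by rewrite dz in Hcxd; rewrite -cyc3_rot.
have [dv|dv] := eqVneq d v.
  move: (HJ _ _ _ _ Hxzv Hcxd); rewrite dv Ec Ex Ev => /HV.
  by rewrite cyc3_rot // eq_sym.
have xc' : x != c by rewrite eq_sym.
have [Fc Fx Fd] := cyc3E dc dx xc'.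
have Fz : cyc3 c x d z = z by apply: cyc3_notin => //; rewrite eq_sym.
have Fv : cyc3 c x d v = v by apply: cyc3_notin => //; rewrite eq_sym.
(* Now [d] is a fifth point. Conjugating (x z v) twice by (c x d) moves [x] to [d], then to [c];
   conjugating (x z v) by the inverse of the result gives (x c z). *)
have Hczv : cyc3 c z v \in H.
  move: (HJ _ _ _ _ Hcxd (HJ _ _ _ _ Hcxd Hxzv)).
  by rewrite Fx Fz Fv Fd Fz Fv.
have [Gc Gv Gz] := cyc3E zc zv vc.
have Gx : cyc3 c v z x = x by apply: cyc3_notin.
by move: (HJ _ _ _ _ (HV _ _ _ Hczv) Hxzv); rewrite Gx Gz Gv => /HV.
Qed.

(** The 3-cycles yield all products of two transpositions; the odd [w] then yields each single
    transposition. *)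
Lemma all_cyc3_odd (H : {group {perm T}}) w :
  (forall x z v, uniq [:: x; z; v] -> cyc3 x z v \in H) ->
  w \in H -> odd_perm w -> H :=: [set: {perm T}].
Proof.
move=> H3 Hw odd_w.
have H2 x z v : x != z -> x != v -> tperm x z * tperm x v \in H.
  move=> xz xv; have [->|zv] := eqVneq z v; first by rewrite tperm2 group1.
  by apply: H3; rewrite /= !inE negb_or xz xv zv.
have H22 a b c d : a != b -> c != d -> tperm a b * tperm c d \in H.
  move=> ab cd; have [ac|ac] := eqVneq a c.
    by rewrite -ac in cd *; apply: H2.
  (* Inserting [tperm a c] twice leaves two products whose transpositions share a point, [a] or
     [c]. *)
  rewrite -(mulgKV (tperm a c) (tperm a b)) tpermV -mulgA {2}(tpermC a c).
  by rewrite groupM ?H2 // eq_sym.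
have even_or_odd a b s : a != b -> (if odd_perm s then tperm a b * s else s) \in H.
  move=> ab; have [ts -> {s}] := prod_tpermP s.
  elim: ts => [|[c d] ts IH] /=; first by rewrite big_nil odd_perm1 group1.
  case/andP=> /= cd /IH{IH}; rewrite big_cons odd_permM odd_tperm cd /=.
  case: odd_perm => /= Hs; last by rewrite mulgA groupM ?H22.
  rewrite -(mulgKV (tperm a b) (tperm c d)) tpermV -mulgA groupM //.
  by rewrite H22.
have Htp a b : a != b -> tperm a b \in H.
  by move=> ab; have := even_or_odd a b w ab; rewrite odd_w groupMr.
apply/setP => s; rewrite inE; have [ts -> {s}] := prod_tpermP s.
by move=> /allP ts_neq; rewrite big_seq group_prod // => t /ts_neq; apply: Htp.
Qed.

(** Powers of [w] are transitive off [a] and [y] moves [a], so the group is 2-transitive.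
    Conjugating the given 3-cycle produces one through each ordered pair, and [cyc3_extend] makes
    the third point arbitrary. *)
Lemma gen_cyc3_odd y w a b x1 x2 x3 :
  porbit w b = [set~ a] -> y a != a -> odd_perm w ->
  uniq [:: x1; x2; x3] -> cyc3 x1 x2 x3 \in <<[set y; w]>> ->
  <<[set y; w]>> = [set: {perm T}].
Proof.
pose H := <<[set y; w]>>%G; rewrite -[<<_>>]/(H : {set _}) => wb ya odd_w x_uniq H3.
have Hy : y \in H by rewrite mem_gen // !inE eqxx.
have Hw : w \in H by rewrite mem_gen // !inE eqxx orbT.
have wtrans c d : c != a -> d != a -> exists2 h, h \in H & h a = a /\ h c = d.
  move=> ca da; have wE z : z != a -> porbit w z = porbit w b.
    by move=> za; apply/eqP; rewrite eq_porbit_mem wb !inE.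
  have /porbitP[i ->] : d \in porbit w c by rewrite wE // -(wE d) // porbit_id.
  by exists (w ^+ i); rewrite ?groupX // permX_fix // (porbit_setC1_fix wb).
have to_a x : exists2 h, h \in H & h x = a.
  have [->|xa] := eqVneq x a; first by exists 1; rewrite ?group1 ?perm1.
  (* The preimage of [a] under [y] differs from [a], so it can be reached from [x]; [y] then leads
     to [a]. *)
  have [|h Hh [_ hx]] := wtrans x (y^-1 a) xa.
    by apply: contraNneq ya => ya; rewrite -{1}ya permKV.
  by exists (h * y); rewrite ?groupM // permM hx permKV.
have two_trans x z : x != z -> exists2 h, h \in H & h x1 = x /\ h x2 = z.
  move=> xz; have [h Hh hx] := to_a x1; have [k Hk kx] := to_a x.
  (* With [x1] and [x] both sent to [a], the second points are aligned by some [g] fixing [a]. *)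
  have [||g Hg [ga gh]] := wtrans (h x2) (k z).
  - rewrite -hx inj_eq; last exact: perm_inj.
    by move: x_uniq; rewrite /= !inE negb_or eq_sym => /andP[/andP[]].
  - by rewrite -kx inj_eq 1?eq_sym //; apply: perm_inj.
  by exists (h * g * k^-1); rewrite ?groupM ?groupV // !permM hx ga gh -kx !permK.
have some3 x z : x != z -> exists v, uniq [:: x; z; v] /\ cyc3 x z v \in H.
  move=> xz; have [h Hh [hx hz]] := two_trans x z xz.
  exists (h x3); rewrite -hx -hz -cyc3J groupJ //.
  by rewrite -[[:: _; _; _]]/(map h [:: x1; x2; x3]) map_inj_uniq //; apply: perm_inj.
apply: all_cyc3_odd odd_w => // x z c.
rewrite /= !inE negb_or andbT => /andP[/andP[xz xc] zc].
have [v [uv Hv]] := some3 x z xz; have [<-//|vc] := eqVneq v c.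
have cx : c != x by rewrite eq_sym.
have [d [ud Hd]] := some3 c x cx.
move: uv ud; rewrite /= !inE !negb_or !andbT => /andP[/andP[_ xv] zv] /andP[/andP[_ cd] xd].
apply: (cyc3_extend _ _ _ Hv Hd); rewrite 1?eq_sym //.
by rewrite /= !inE !negb_or xz xv xc zv zc vc.
Qed.

Lemma porbitJ s h x : porbit (s ^ h) (h x) = h @: porbit s x.
Proof.
apply/setP => v; apply/porbitP/imsetP => [[i ->]|[_ /porbitP[i ->] ->]].
  by exists ((s ^+ i) x); rewrite ?mem_porbit // -conjXg permJ.
by exists i; rewrite -conjXg permJ.
Qed.

Lemma imset_setC1 h a : h @: [set~ a] = [set~ h a].
Proof.
apply/setP => v; rewrite -[v](permKV h) mem_imset; last exact: perm_inj.
by rewrite !inE inj_eq //; apply: perm_inj.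
Qed.

Lemma odd_porbit_setC1 s x a : porbit s x = [set~ a] -> odd #|T| -> odd_perm s.
Proof.
move=> sx oddT; rewrite /odd_perm oddT.
have sa := porbit_setC1_fix sx.
have orb_a : porbit s a = [set a].
  apply/setP => v; rewrite inE; apply/porbitP/eqP => [[i ->]|->]; first exact: permX_fix.
  by exists 0; rewrite perm1.
suff -> : porbits s = [set [set a]; [set~ a]].
  by rewrite cards2; case: eqP => // /setP/(_ a); rewrite !inE eqxx.
apply/setP => A; rewrite !inE; apply/imsetP/orP => [[v _ ->]|[]/eqP->]; last 2 first.
- by exists a.
- by exists x.
have [->|va] := eqVneq v a; [by left; rewrite orb_a | right].
by rewrite -sx eq_porbit_mem sx !inE.
Qed.

(** * Partners of a transposition and of an even permutation with many stable sets *)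

(** Among three points, two lie on the same side of the orbit of [x]; their transposition stabilises
    that orbit, as [u] does, so the orbit cannot be proper. *)
Lemma gen_tperm_porbit_setT u x : 2 < #|T| ->
  (forall a b, a != b -> <<[set tperm a b; u]>> = [set: {perm T}]) ->
  porbit u x = setT.
Proof.
move=> T_gt2 gen; apply/eqP/negPn/negP => u_intrans.
have [a [b ab eq_ab]] : exists a, exists2 b, a != b & (a \in porbit u x) = (b \in porbit u x).
  have /injectivePn[a [b ab eq_ab]] : ~~ injectiveb (fun v => v \in porbit u x).
    by apply/negP => /injectiveP /leq_card; rewrite card_bool leqNgt T_gt2.
  by exists a, b.
have st : stable (tperm a b) (porbit u x).
  by apply/stableP => v; case: tpermP => [->|->|].
have orb_neq0 : porbit u x != set0 by apply/set0Pn; exists x; apply: porbit_id.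
by have := gen_stable_proper st (stable_porbit u x) orb_neq0 u_intrans; rewrite gen ?eqxx.
Qed.

Lemma gen_even_odd y w x z : x != z -> ~~ odd_perm y ->
  <<[set w; y]>> = [set: {perm T}] -> odd_perm w.
Proof.
move=> xz even_y gen; apply: contraT => even_w.
have /subsetP/(_ (tperm x z)) : <<[set w; y]>> \subset 'Alt_T.
  by rewrite gen_subG subUset !sub1set !Alt_even even_w.
by rewrite gen inE Alt_even odd_tperm xz => /(_ isT).
Qed.

(* If w stabilised a set of size k with 1 < k < #|T| - 1, some conjugate of w
   would stabilise the same set as y. *)
Lemma gen_even_porbit_setC1 y w : odd #|T| -> ~~ odd_perm y ->
  (forall k, 1 < k < #|T|.-1 -> exists2 A, stable y A & #|A| = k) ->
  (forall h, <<[set w ^ h; y]>> = [set: {perm T}]) -> odd_perm w ->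
  exists a b, porbit w b = [set~ a].
Proof.
move=> oddT even_y y_stable gen odd_w.
have /existsP[b wb] : [exists b, w b != b].
  apply: contraLR odd_w => /existsPn w1; suff -> : w = 1 by rewrite odd_perm1.
  by apply/permP => v; rewrite perm1; apply/eqP/negPn/w1.
have orb_gt1 : 1 < #|porbit w b|.
  have <- : #|[set b; w b]| = 2 by rewrite cards2 eq_sym wb.
  by rewrite subset_leq_card // subUset !sub1set porbit_permE porbit_id.
(* In odd degree a full cycle is even, so this orbit is not everything. *)
have orb_ltT : #|porbit w b| < #|T|.
  rewrite -cardsT proper_card // properT; apply: contraL odd_w => /eqP wT.
  exact: odd_porbit_setT wT oddT.
have [lt_orb|ge_orb] := ltnP #|porbit w b| #|T|.-1.
  have [|A yA cardA] := y_stable #|porbit w b|; first by rewrite orb_gt1.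
  have [||h] := conj_stable_gen_proper (stable_porbit w b) yA.
  - by rewrite cardA.
  - by rewrite cardA orb_ltT (ltnW orb_gt1).
  by rewrite gen eqxx.
have /cards1P[a wa] : #|~: porbit w b| == 1%N.
  by rewrite cardsCs setCK; apply/eqP; lia.
by exists a, b; rewrite -wa setCK.
Qed.

End Permutations.

(** * The even permutation with stable sets of all intermediate sizes *)

Section Blocks.

(* For [b = false] the cycles (0 1 2)(3 4)(5 6)(7 8)...; for [b = true] the
   cycles (0 1 2)(3 4 5 6)(7 8)... *)
Definition blocks (b : bool) (i : nat) : nat :=
  if i == 2 then 0 else if b && (i == 6) then 3 else
  if [|| i < 2, b && (i < 7) | odd i] then i.+1 else i.-1.

Lemma blocks_swap b i : 2 < i -> ~~ (b && (i < 7)) -> blocks b (blocks b i) = i.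
Proof.
move=> i_gt2 nb; have E : blocks b i = if odd i then i.+1 else i.-1.
  by rewrite /blocks; do ?case: ifP; lia.
by rewrite E; case: ifP => oi; rewrite /blocks; do ?case: ifP; lia.
Qed.

(** The exponent 4 kills the 2-cycles and the 4-cycle but leaves the 3-cycle on 0, 1, 2 unchanged,
    as 4 is 1 modulo 3. *)
Lemma blocks_iter4 b i : 2 < i -> iter 4 (blocks b) i = i.
Proof.
move=> i_gt2; have [/andP[-> lt7]|nb] := boolP (b && (i < 7)).
  by case: i i_gt2 lt7; do 7?case=> //.
by rewrite /= !blocks_swap.
Qed.

Variable n : nat.
Hypotheses (n_odd : odd n) (n_ge7 : 7 <= n).

Lemma ex_blocks_perm b : exists y : 'S_n, forall i, y i = blocks b i :> nat.
Proof.
(* For odd [i < n] the value [i.+1] is in range because [n] is odd; values up to 6 are in range by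
   [7 <= n]. *)
have lt_blocks (i : 'I_n) : blocks b i < n.
  by have := ltn_ord i; rewrite /blocks; case: (b) => /=; do ?case: ifP; lia.
have inj : injective (fun i => Ordinal (lt_blocks i)).
  move=> i j [] eq_ij; apply: val_inj => /=; move: eq_ij; rewrite /blocks.
  by case: (b) => /=; do ?case: ifP; lia.
by exists (perm inj) => i; rewrite permE.
Qed.

Lemma ex_even_blocks_perm :
  exists b (y : 'S_n), [/\ forall i, y i = blocks b i :> nat, ~~ odd_perm y & b -> 9 <= n].
Proof.
have [y yE] := ex_blocks_perm false.
have [odd_y|even_y] := boolP (odd_perm y); last by exists false, y; split.
exists true.
have [n9|n7] := leqP 9 n.
  have [lt3 lt5] : 3 < n /\ 5 < n by lia.
  pose i3 := Ordinal lt3; pose i5 := Ordinal lt5.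
  (* Multiplying by (3 5) merges (3 4)(5 6) into (3 4 5 6) and flips the parity. *)
  exists (y * tperm i3 i5)%g; split=> //; last first.
    by rewrite odd_permM odd_y odd_tperm.
  move=> i; rewrite permM; case: tpermP => [yi|yi|].
  - by move: (yE i); rewrite yi /blocks /=; do ?case: ifP; lia.
  - by move: (yE i); rewrite yi /blocks /=; do ?case: ifP; lia.
  move=> /eqP y3 /eqP y5; have {}y3 : y i != 3 :> nat by [].
  have {}y5 : y i != 5 :> nat by [].
  by move: y3 y5; rewrite yE /blocks /=; do ?case: ifP; lia.
(* For [n = 7] the cycle type is (3, 2, 2), already even, so the 4-cycle occurs only from degree 9
   on. *)
have n_eq7 : n = 7 by lia.
suff: ~~ odd_perm y by rewrite odd_y.
move: y yE {odd_y}; rewrite n_eq7 => y yE.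
pose o k (lt : k < 7) := Ordinal lt.
have -> : y = (tperm (@o 0%N isT) (@o 1%N isT) * tperm (@o 0%N isT) (@o 2%N isT)
    * tperm (@o 3%N isT) (@o 4%N isT) * tperm (@o 5%N isT) (@o 6%N isT))%g.
  apply/permP => i; apply: val_inj; rewrite [LHS]yE !permM !permE /=.
  by case: i; do 7?case=> //.
by rewrite !odd_permM !odd_tperm.
Qed.

Lemma card_val_in (s : seq nat) :
  uniq s -> all (gtn n) s -> #|[set i : 'I_n | (i : nat) \in s]| = size s.
Proof.
move=> s_uniq /allP s_lt; rewrite cardE -(size_map val).
apply/perm_size/uniq_perm => // [|k].
  by rewrite map_inj_uniq ?enum_uniq //; apply: val_inj.
apply/mapP/idP => [[i]|ks]; first by rewrite mem_enum inE => si ->.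
by exists (Ordinal (s_lt _ ks)); rewrite ?mem_enum ?inE.
Qed.

Lemma blocks_stable b (y : 'S_n) k :
  (forall i, y i = blocks b i :> nat) -> (b -> 9 <= n) -> 1 < k < n.-1 ->
  exists2 A : {set 'I_n}, stable y A & #|A| = k.
Proof.
move=> yE b9.
(* Complements exchange even and odd sizes, [n] being odd. For odd [k] the first [k] points are the
   3-cycle followed by whole cycles, with one exception. *)
wlog k_odd : k / odd k => [IH k_n|].
  have [k_odd|k_even] := boolP (odd k); first exact: IH.
  have [||A yA cardA] := IH (n - k); [lia | lia |].
  exists (~: A); first exact: stableC.
  by rewrite cardsCs setCK card_ord cardA; lia.
(* The exception: five initial points would cut (3 4 5 6), so the 3-cycle is joined with (7 8)
   instead. *)
move=> k_n; have [/andP[bT /eqP k5]|nb] := boolP (b && (k == 5)).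
  exists [set i : 'I_n | (i : nat) \in [:: 0; 1; 2; 7; 8]].
    by apply/stableP => i; rewrite !inE /= yE /blocks bT /=; do ?case: ifP; lia.
  by rewrite card_val_in ?k5 //=; have := b9 bT; lia.
exists [set i : 'I_n | (i : nat) \in iota 0 k].
  by apply/stableP => i; rewrite !inE !mem_iota yE /blocks; do ?case: ifP; lia.
rewrite card_val_in ?size_iota ?iota_uniq //.
by apply/allP => i; rewrite mem_iota /=; lia.
Qed.

Lemma blocks_no_fix b (y : 'S_n) a :
  (forall i, y i = blocks b i :> nat) -> y a != a.
Proof.
by move=> yE; rewrite -val_eqE /= yE /blocks; case: (b) => /=; do ?case: ifP; lia.
Qed.

Lemma blocks_X4 b (y : 'S_n) : (forall i, y i = blocks b i :> nat) ->
  exists x1 x2 x3, uniq [:: x1; x2; x3] /\ (y ^+ 4)%g = cyc3 x1 x2 x3.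
Proof.
move=> yE.
have [[lt0 lt1] lt2] : (0 < n /\ 1 < n) /\ 2 < n by lia.
pose x1 := Ordinal lt0; pose x2 := Ordinal lt1; pose x3 := Ordinal lt2.
exists x1, x2, x3; split=> //; apply/permP => i.
have y4 : (y ^+ 4)%g i = iter 4 (blocks b) i :> nat by rewrite permX /= !yE.
apply: val_inj; rewrite [LHS]y4.
have [E1 E2 E3] := @cyc3E _ x1 x2 x3 isT isT isT.
have [->|i1] := eqVneq i x1; first by rewrite E1; case: (b).
have [->|i2] := eqVneq i x2; first by rewrite E2; case: (b).
have [->|i3] := eqVneq i x3; first by rewrite E3; case: (b).
rewrite cyc3_notin // blocks_iter4 //; move: i1 i2 i3; rewrite -!val_eqE /=; lia.
Qed.

End Blocks.

(** * A full cycle and a cycle missing one point inside the affine group *)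

Section AffineGroup.
Import GRing.Theory.
Local Open Scope ring_scope.

Lemma affine_pair p : prime p -> (3 < p)%N ->
  exists u w : 'S_p, exists x a b,
    [/\ porbit u x = setT, porbit w b = [set~ a] & <<[set u; w]>>%g != setT].
Proof.
move=> p_pr p_gt3.
suff: exists u w : {perm 'F_p}, exists x a b,
    [/\ porbit u x = setT, porbit w b = [set~ a] & <<[set u; w]>>%g != setT].
  (* The carrier of ['F_p] is an ordinal type whose bound equals [p] by [Fp_cast]. *)
  by move=> F_pair; rewrite -(Fp_cast p_pr).
have /cyclicP[g gen_g] := field_unit_group_cyclic [set: {unit 'F_p}]%G.
pose u := perm (addIr (1 : 'F_p)).
have g_neq0 : val g != 0 by rewrite -unitfE; apply: valP.
pose w := perm (mulIf g_neq0).
have uX i x : (u ^+ i)%g x = x + i%:R.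
  elim: i => [|i IH]; first by rewrite perm1 addr0.
  by rewrite expgSr permM IH permE -addrA -natr1.
have wX i x : (w ^+ i)%g x = x * val g ^+ i.
  elim: i => [|i IH]; first by rewrite perm1 mulr1.
  by rewrite expgSr permM IH permE -mulrA -exprSr.
exists u, w, 0, 0, 1; split.
- apply/setP => x; rewrite inE; apply/porbitP; exists x.
  by rewrite uX add0r natr_Zp.
- apply/setP => x; rewrite !inE; apply/porbitP/idP => [[i ->]|x_neq0].
    by rewrite wX mul1r expf_neq0.
  rewrite -unitfE in x_neq0.
  have : FinRing.unit _ x_neq0 \in <[g]>%g by rewrite -gen_g inE.
  case/cycleP=> i gi; exists i; rewrite wX mul1r.
  by rewrite -FinRing.val_unitX -gi.
pose affine := [set s : {perm 'F_p} | [exists a, exists b, forall x, s x == a * x + b]].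
have affine_group : group_set affine.
  apply/group_setP; split=> [|s t]; rewrite !inE.
    apply/existsP; exists 1; apply/existsP; exists 0; apply/forallP => x.
    by rewrite perm1 mul1r addr0.
  case/existsP=> a /existsP[b /forallP sE]; case/existsP=> c /existsP[d /forallP tE].
  apply/existsP; exists (c * a); apply/existsP; exists (c * b + d).
  by apply/forallP => x; rewrite permM (eqP (tE _)) (eqP (sE _)) mulrDr mulrA addrA.
have sub : <<[set u; w]>>%g \subset group affine_group.
  rewrite gen_subG subUset !sub1set !inE; apply/andP; split; apply/existsP.
    exists 1; apply/existsP; exists 1; apply/forallP => x.
    by rewrite permE mul1r.
  exists (val g); apply/existsP; exists 0; apply/forallP => x.
  by rewrite permE mulrC addr0.
have small_neq0 i : (0 < i < p)%N -> i%:R != 0 :> 'F_p.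
  by move=> i_p; rewrite -(dvdn_pcharf (pchar_Fp p_pr)) gtnNdvd //; case/andP: i_p.
apply/eqP => gen; move: sub; rewrite gen => /subsetP/(_ (tperm 0 1)).
rewrite !inE => /(_ isT) /existsP[a /existsP[b /forallP tE]].
(* An affine map swapping 0 and 1 is [1 - x]; since the transposition fixes 2, this would give 3 =
   0, against [3 < p]. *)
move: (eqP (tE 0)) (eqP (tE 1)) (eqP (tE 2)); rewrite tpermL tpermR tpermD; first last.
- by rewrite -subr_eq0 -opprB oppr_eq0 -[2]natr1 addrK; apply: (small_neq0 1%N); rewrite /=; lia.
- by rewrite eq_sym; apply: (small_neq0 2); lia.
rewrite mulr0 add0r mulr1 => <- /eqP; rewrite eq_sym addr_eq0 => /eqP->.
move/eqP; rewrite mulN1r -subr_eq0 opprD opprK addrA (_ : 2 + 2 - 1 = 3%:R).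
  by apply/negP/small_neq0; lia.
by rewrite -!natrD -[4]natr1 addrK.
Qed.

End AffineGroup.

(** * The invariably generating graph of a full group *)

Section LambdaFullGroup.
Local Open Scope group_scope.
Variable gT : finGroupType.
Implicit Types (A B : Lambda [set: gT]%G) (x y : gT).

Lemma ex_class x : x != 1 -> exists A : Lambda [set: gT]%G, val A = x ^: [set: gT].
Proof.
move=> x1; have ntA : nontrivial_class [set: gT]%G (x ^: [set: gT]).
  by apply/setD1P; rewrite classG_eq1 mem_classes ?inE.
by exists (Sub (x ^: [set: gT]) ntA).
Qed.

Lemma class_nonempty A : exists x, x \in val A.
Proof.
have /setD1P[_ /imsetP[x _ Ax]] := valP A.
by exists x; rewrite [val A]Ax class_refl.
Qed.

Lemma mem_classJ A x h : x \in val A -> x ^ h \in val A.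
Proof.
have /setD1P[_ /imsetP[z _ Az]] := valP A.
by rewrite [val A]Az => /imsetP[g _ ->]; rewrite -conjgM imset_f ?inE.
Qed.

Lemma adj_gen A B x y :
  adj A B -> x \in val A -> y \in val B -> <<[set x; y]>> = [set: gT].
Proof.
move=> AB xA yB; have /andP[neqAB _] := AB.
move: AB; rewrite /= (lambda_adjP xA yB neqAB) => /andP[_ /forall_inP gen].
pose one : {ffun gT -> gT} := [ffun=> 1].
have one_on : one \in ffun_on (mem [set: gT]%G).
  by apply/ffun_onP => z; rewrite ffunE inE.
by rewrite -(eqP (gen _ one_on)) imsetU1 imset_set1 !ffunE !conjg1.
Qed.

(** Independent conjugates of two representatives are again representatives, so quantifying over [x]
    and [y] covers every choice of conjugators. *)
Lemma gen_adj A B : A != B ->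
  (forall x y, x \in val A -> y \in val B -> <<[set x; y]>> = [set: gT]) ->
  adj A B.
Proof.
move=> neqAB gen; have [x xA] := class_nonempty A; have [y yB] := class_nonempty B.
rewrite /= (lambda_adjP xA yB neqAB); apply/andP; split; first exact: subsetT.
apply/forall_inP => g _; rewrite imsetU1 imset_set1.
by apply/eqP/gen; apply: mem_classJ.
Qed.

End LambdaFullGroup.

Section DiameterBound.
Import Order.TTheory Num.Theory.

(** The default [+oo] of the minimum also exceeds [d], so the bound covers points joined by no
    walk. *)
Lemma diam_ge (Gr : sgraph) (x y : Gr) (d : nat) :
  (forall k, k < d -> ~~ walk k x y) -> (d%:Z%:E <= diam Gr)%E.
Proof.
move=> no_walk; apply: (bigmax_sup x) => //; apply: (bigmax_sup y) => //.
apply: le_bigmin => [|k]; first exact: leey.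
by apply: contraTT; rewrite lee_fin lez_nat -ltnNge; apply: no_walk.
Qed.

End DiameterBound.

Theorem lemma4p5 (n : nat) (n_ge7 : 7 <= n) (n_prime : prime n) :
  (4%:E <= diam (Xi [set: 'S_n]%G))%E.
Proof.
have n_odd : odd n by case: (even_prime n_prime) => // n2; rewrite n2 in n_ge7.
have cardT : #|'I_n| = n by rewrite card_ord.
have [lt0 lt1] : 0 < n /\ 1 < n by lia.
pose i0 := Ordinal lt0; pose i1 := Ordinal lt1.
have [b [y [yE even_y b9]]] := ex_even_blocks_perm n_odd n_ge7.
have y_stable := blocks_stable n_odd n_ge7 yE b9.
have y_nofix c : y c != c by apply: blocks_no_fix yE.
have [x1 [x2 [x3 [x_uniq y4]]]] := blocks_X4 n_odd n_ge7 yE.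
have [u [w [c [a [d [uc wd uw_proper]]]]]] := affine_pair n_prime (@leq_trans 7 4 n isT n_ge7).
have even_u : ~~ odd_perm u by apply: odd_porbit_setT uc _; rewrite cardT.
have odd_w : odd_perm w by apply: odd_porbit_setC1 wd _; rewrite cardT.
pose t := tperm i0 i1.
have odd_t : odd_perm t by rewrite odd_tperm.
have odd_neq1 (s : 'S_n) : odd_perm s -> s != 1%g by apply: contraTneq => ->; rewrite odd_perm1.
have [tA tAE] := ex_class (odd_neq1 t odd_t).
have [wA wAE] := ex_class (odd_neq1 w odd_w).
have [yA yAE] : exists A : Lambda [set: 'S_n]%G, val A = (y ^: [set: 'S_n])%g.
  by apply: ex_class; apply: contraNneq (y_nofix i0) => ->; rewrite perm1.
have [uA uAE] : exists A : Lambda [set: 'S_n]%G, val A = (u ^: [set: 'S_n])%g.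
  apply: ex_class; apply/eqP => u1.
  have c_fix e : e = c.
    have : e \in porbit u c by rewrite uc inE.
    by rewrite u1 => /porbitP[i ->]; rewrite expg1n perm1.
  by have : i0 = i1 by rewrite (c_fix i0) (c_fix i1).
have class_odd (A : Lambda [set: 'S_n]%G) s r :
    val A = (s ^: [set: 'S_n])%g -> r \in val A -> odd_perm r = odd_perm s.
  by move=> -> /imsetP[h _ ->]; rewrite odd_permJ.
have class_neq (A B : Lambda [set: 'S_n]%G) s r :
    val A = (s ^: [set: 'S_n])%g -> val B = (r ^: [set: 'S_n])%g ->
    odd_perm s -> ~~ odd_perm r -> A != B.
  move=> As Br odd_s even_r; apply: contraNneq even_r => AB.
  by rewrite -(class_odd A r s) // ?AB // -AB As class_refl.
have adj_tu : adj tA uA.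
  apply: gen_adj (class_neq _ _ _ _ tAE uAE odd_t even_u) _ => s r.
  rewrite tAE uAE => /imsetP[h _ ->] /imsetP[k _ ->]; rewrite tpermJ.
  (* In prime degree any transposition and any full cycle generate. *)
  apply: gen_tperm_circular_shift; rewrite ?cardT //; first by rewrite inj_eq //; apply: perm_inj.
  by rewrite orderJ (order_porbit_setT uc) cardT.
have adj_yw : adj yA wA.
  rewrite adj_sym; apply: gen_adj (class_neq _ _ _ _ wAE yAE odd_w even_y) _ => s r.
  rewrite wAE yAE setUC => /imsetP[k _ ->] /imsetP[h _ ->].
  (* The two conjugators act separately: [k] transports the orbit of [w], and [h] the 3-cycle
     [y ^+ 4]. *)
  apply: (@gen_cyc3_odd _ _ _ (k a) (k d) (h x1) (h x2) (h x3)).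
  - by rewrite porbitJ wd imset_setC1.
  - by rewrite -[k a](permKV h) permJ inj_eq //; apply: perm_inj.
  - by rewrite odd_permJ.
  - by rewrite -[[:: _; _; _]]/(map h [:: x1; x2; x3]) map_inj_uniq //; apply: perm_inj.
  by rewrite -cyc3J -y4 conjXg groupX // mem_gen // !inE eqxx.
have t_nbr (U : Lambda [set: 'S_n]%G) v e : adj tA U -> v \in val U -> porbit v e = setT.
  move=> tU vU; apply: gen_tperm_porbit_setT => [|f g fg].
    by rewrite cardT; apply: leq_trans n_ge7.
  have [|h map_h] := @ex_perm_map _ [:: i0; i1] [:: f; g] isT _ (erefl _).
    by rewrite /= inE fg.
  case: map_h => <- <-; rewrite -tpermJ; apply: adj_gen tU _ vU.
  by apply: mem_classJ; rewrite tAE class_refl.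
have y_nbr (W : Lambda [set: 'S_n]%G) v : adj W yA -> v \in val W ->
    exists a' d', porbit v d' = [set~ a'].
  move=> Wy vW; have gen h : <<[set v ^ h; y]>>%g = [set: 'S_n].
    by apply: (adj_gen Wy); rewrite ?mem_classJ // yAE class_refl.
  apply: (gen_even_porbit_setC1 _ even_y _ gen); rewrite ?cardT //.
  by have := gen 1%g; rewrite conjg1; apply: (@gen_even_odd _ _ _ i0 i1).
have tA_non : nonisolated tA by apply/existsP; exists uA.
have yA_non : nonisolated yA by apply/existsP; exists wA.
pose tX : Xi [set: 'S_n]%G := Sub tA tA_non.
pose yX : Xi [set: 'S_n]%G := Sub yA yA_non.
apply: (@diam_ge _ tX yX 4) => k k4; apply/existsP => -[p].
(* Cases by decreasing walk length: at least 4, then 3, 2, 1 and 0. *)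
case: p => [[|B1 [|B2 [|B3 [|B4 p]]]] size_p] /andP[]; last first.
- by exfalso; move: k4; rewrite -(eqP size_p).
- case/and4P=> tB1 B12 B23 _ /eqP B3y.
  have {}B23 : adj (val B2) yA by rewrite -[yA]/(val yX) -B3y.
  have [v1 v1B] := class_nonempty (val B1); have [v2 v2B] := class_nonempty (val B2).
  have v1c := t_nbr _ _ i0 tB1 v1B; have [a' [d' v2d]] := y_nbr _ _ B23 v2B.
  (* By conjugacy [B1] contains [u] and [B2] contains [w], so these would generate. *)
  have [h1 v1h] := transitive_conj v1c uc; have [h2 v2h] := porbit_setC1_conj v2d wd.
  case/eqP: uw_proper; apply: (adj_gen B12); first by rewrite -v1h mem_classJ.
  by rewrite -v2h mem_classJ.
- case/and3P=> tB1 B12 _ /eqP B2y.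
  have {}B12 : adj (val B1) yA by rewrite -[yA]/(val yX) -B2y.
  have [v vB] := class_nonempty (val B1); have [a' [d' vd]] := y_nbr _ _ B12 vB.
  (* A common neighbour would be a full cycle with a fixed point. *)
  by have := t_nbr _ _ d' tB1 vB; rewrite vd => /setP/(_ a'); rewrite !inE eqxx.
- case/andP=> tB1 _ /eqP B1y.
  have {}tB1 : adj tA yA by rewrite -[yA]/(val yX) -B1y.
  (* Both [t] and [y] stabilise a set of size 2. *)
  have [|A yst cardA] := y_stable 2; first by rewrite -subn1 ltn_subRL (leq_trans _ n_ge7).
  have tst : stable t [set i0; i1].
    by apply/stableP => e; apply: perm_closed; apply: tperm_on.
  have [||h] := conj_stable_gen_proper tst yst.
  - by rewrite cardA cards2.
  - by rewrite cardA cardT (leq_trans _ n_ge7).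
  case/eqP; apply: (adj_gen tB1); last by rewrite yAE class_refl.
  by apply: mem_classJ; rewrite tAE class_refl.
move=> _ /eqP/(congr1 val) ty.
by have := class_neq _ _ _ _ tAE yAE odd_t even_y; rewrite [tA]ty eqxx.
Qed.
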